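(* Let $d>1$ be an integer, let $i\in\{1,\ldots,d\}$, and let $$A:=\{\mathbf{e}_1,\ldots,\mathbf{e}_{i-1},a_1\mathbf{e}_i,a_2\mathbf{e}_i,a_3\mathbf{e}_i,\mathbf{e}_{i+1},\ldots,\mathbf{e}_d\}\cup\{\mathbf{e}_i+d_j\mathbf{e}_j\mid j\in\{1,\ldots,d\}\setminus\{i\}\}\subseteq\mathbb{N}^d$$ be such that $a_1,a_2,a_3$ minimally generate a numerical semigroup and $d_j\in\mathbb{N}\setminus\{0\}$ for all $j\in\{1,\ldots,d\}\setminus\{i\}$. Let $S=\langle A\rangle$. Then the following hold: (1) If $d\geq 3$, then $|\operatorname{FA}(S)|\geq 2$. (2) If $d=2$ and $a_1\neq 3$, then $|\operatorname{FA}(S)|\geq 2$. (3) If $d=2$ and $a_1=3$, then $|\operatorname{FA}(S)|=1$ if and only if $a_2\equiv 1 \pmod 3$ and $a_3=a_2+1$.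
   Context: $\mathbb{N}$ is the set of nonnegative integers; $\mathbf{e}_1,\ldots,\mathbf{e}_d$ are the standard basis vectors of $\mathbb{R}^d$; $\langle A\rangle$ is the submonoid of $\mathbb{N}^d$ generated by $A$. A numerical semigroup is a submonoid of $\mathbb{N}$ with finite complement in $\mathbb{N}$; $a_1,a_2,a_3$ minimally generate a numerical semigroup if $\langle a_1,a_2,a_3\rangle$ is a numerical semigroup and no proper subset of $\{a_1,a_2,a_3\}$ generates it. A generalized numerical semigroup is a submonoid $S\subseteq\mathbb{N}^d$ whose set of gaps $\mathcal{H}(S)=\mathbb{N}^d\setminus S$ is finite (the $S$ in the claim is one). The natural partial order is $\mathbf{x}\leq_{\mathbb{N}^d}\mathbf{y}$ if and only if $\mathbf{y}-\mathbf{x}\in\mathbb{N}^d$, and $\operatorname{FA}(S)$ (the Frobenius-allowable elements) is the set of maximal elements of $\mathcal{H}(S)$ with respect to $\leq_{\mathbb{N}^d}$.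
   Formalization: The generators a1, a2, a3 are taken distinct, and parts (2) and (3) assume a1 < a2 < a3; without the ordering (4,3,5) violates (2) and (3,5,4) violates (3), since S depends only on the set {a1,a2,a3}; with repetition (2,3,3) violates (1). *)

(* Defs.v *)
From HB Require Import structures.
From mathcomp Require Import all_boot all_order all_algebra.
From mathcomp Require Import boolp classical_sets functions cardinality.

Set Implicit Arguments.
Unset Strict Implicit.
Unset Printing Implicit Defensive.

Import GRing.Theory.
Local Open Scope classical_set_scope.
Local Open Scope ring_scope.

(* Elements of N^d are row vectors 'rV[nat]_d, the coordinates being indexed
   by 'I_d = {0, ..., d - 1}. *)

Definition submonoid (V : nmodType) (M : set V) : Prop :=
  M 0 /\ forall x y, M x -> M y -> M (x + y).

Definition generated (V : nmodType) (A : set V) : set V :=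
  smallest (@submonoid V) A.

Definition numerical_semigroup (H : set nat) : Prop :=
  submonoid H /\ finite_set (~` H).

(* [uniq s] makes "s_1, ..., s_n minimally generate" a property of the listed
   generators: repetitions are invisible in the set [set` s]. *)
Definition minimally_generate_numerical_semigroup (s : seq nat) : Prop :=
  [/\ uniq s,
      numerical_semigroup (generated [set` s])
    & forall B : set nat, B `<` [set` s] -> generated B <> generated [set` s]].

Definition gaps (d : nat) (S : set 'rV[nat]_d) : set 'rV[nat]_d := ~` S.

(* Subtraction being unavailable in 'rV[nat]_d, "y - x lies in N^d" is
   expressed by naming the difference. *)
Definition natural_le (d : nat) (x y : 'rV[nat]_d) : Prop :=
  exists z : 'rV[nat]_d, y = x + z.

Definition FA (d : nat) (S : set 'rV[nat]_d) : set 'rV[nat]_d :=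
  [set x | gaps S x /\ forall y, gaps S y -> natural_le x y -> y = x].

Definition basis_vec (d : nat) (j : 'I_d) : 'rV[nat]_d := delta_mx 0 j.

Definition gen_set (d : nat) (i : 'I_d) (a1 a2 a3 : nat) (D : 'I_d -> nat) :
    set 'rV[nat]_d :=
  [set basis_vec j | j in [set~ i]] `|`
  [set basis_vec i *+ a1; basis_vec i *+ a2; basis_vec i *+ a3] `|`
  [set basis_vec i + basis_vec j *+ D j | j in [set~ i]].

(* Main.v *)
Require Import Defs.
From mathcomp Require Import all_boot all_order all_algebra.
From mathcomp Require Import boolp classical_sets functions cardinality.
From mathcomp Require Import zify.

(** Write H for the numerical semigroup generated by [a1], [a2], [a3]; let F be
    its largest gap and m its multiplicity, so that m >= 3. A generator
    e_i + D_j e_j trades D_j units of coordinate j for one unit of coordinate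
    i, whereas units of the coordinates other than i are free. Hence x lies in
    S exactly when x_i - t is in H for some t <= N(x), where N(x) is the sum
    over j <> i of the quotients x_j %/ D_j ([generated_gen_setE]); that is,
    x is a gap when the window of integers from x_i - N(x) to x_i misses H.

    There are finitely many gaps, so each one lies below an element of FA(S)
    ([FA_above]). If FA(S) has at most one element, then a single gap M
    dominates all gaps, in particular F e_i and every
    (m-1) e_i + (m-2) D_j e_j: the window of the latter is 1, ..., m-1. So
    M_i = F and every quotient M_j %/ D_j is at least m-2
    ([dominating_gap]). But a window that misses H contains no multiple of m,
    so N(M) <= m-2 ([max_shift_le_multiplicity]).

    When d >= 3, two indices j contribute 2(m-2) > m-2, a contradiction
    ([card_FA_ge2]). When d = 2, the m-1 integers up to F are all gaps of H
    ([gap_run]). Then F+1 is a multiple of m, and below F+1 the semigroup H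
    only has multiples of m; so F+2, ..., F+m can only be minimal generators.
    There being two generators besides m, this gives m = 3, with F+2 and F+3
    the other two generators ([long_last_run]). Conversely, for the semigroup
    generated by 3, 3k+1 and 3k+2, the integers F and F-1 are gaps, no three
    consecutive integers are, and so F e_i + (2 D_j - 1) e_j dominates every
    gap ([card_FA_eq1]). *)

Set Implicit Arguments.
Unset Strict Implicit.
Unset Printing Implicit Defensive.

Local Open Scope classical_set_scope.
Local Open Scope card_scope.
Local Open Scope nat_scope.

(** * Submonoids and minimal generators *)

Lemma generated_submonoid (V : nmodType) (A : set V) : submonoid (generated A).
Proof.
split=> [M [[M0 _] _]|x y Sx Sy M MA]; first exact: M0.
by case: (MA) => -[_ MD] _; apply: MD; [exact: Sx | exact: Sy].
Qed.

Lemma generated_mulrn (V : nmodType) (A : set V) (x : V) (n : nat) :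
  generated A x -> generated A (x *+ n)%R.
Proof.
have [S0 SD] := generated_submonoid A => Sx.
by elim: n => [|n IHn]; rewrite ?GRing.mulr0n // GRing.mulrS; apply: SD.
Qed.

Lemma generated_muln (A : set nat) (n a : nat) :
  generated A a -> generated A (n * a).
Proof.
have [S0 SD] := generated_submonoid A => Sa.
by elim: n => [//|n IHn]; rewrite mulSn; apply: SD.
Qed.

Lemma generated_sum (V : nmodType) (A : set V) (I : finType) (P : pred I)
    (f : I -> V) :
  (forall j, P j -> generated A (f j)) -> generated A (\sum_(j | P j) f j)%R.
Proof. by have [S0 SD] := generated_submonoid A => Sf; apply: big_ind. Qed.

(** Were [b] generated by the other elements, these would generate the whole
    semigroup, against minimality. *)
Lemma minimal_generator_indispensable (s : seq nat) (b : nat) :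
  minimally_generate_numerical_semigroup s -> b \in s ->
  ~ generated ([set` s] `\ b) b.
Proof.
move=> [_ _ smin] bs Gb; apply: (smin ([set` s] `\ b)).
  split; first exact: subDsetl.
  by move=> /(_ b bs) [_]; apply.
apply/seteqP; split.
  apply: smallest_sub; first exact: generated_submonoid.
  by move=> x [sx _]; exact: sub_gen_smallest.
apply: smallest_sub; first exact: generated_submonoid.
move=> x sx; have [->//|xb] := eqVneq x b.
by apply: sub_gen_smallest; split=> //=; exact/eqP.
Qed.

Lemma minimally_generate_perm (s t : seq nat) : perm_eq s t ->
  minimally_generate_numerical_semigroup s ->
  minimally_generate_numerical_semigroup t.
Proof.
move=> st [us sH smin]; have e : [set` s] = [set` t].
  by apply/seteqP; split=> x /=; rewrite (perm_mem st).
by split; [rewrite -(perm_uniq st) | rewrite -e | rewrite -e].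
Qed.

(** * Three minimal generators of a numerical semigroup *)

Lemma generated3P (m b c n : nat) :
  generated [set` [:: m; b; c]] n ->
  exists x y z : nat, n = x * m + y * b + z * c.
Proof.
pose M := [set n | exists x y z : nat, n = x * m + y * b + z * c].
suff : generated [set` [:: m; b; c]] `<=` M by apply.
apply: smallest_sub.
  split=> [|_ _ [x [y [z ->]]] [x' [y' [z' ->]]]]; first by exists 0, 0, 0.
  by exists (x + x'), (y + y'), (z + z'); rewrite !natrDE; lia.
move=> k /=; rewrite !inE => /or3P[]/eqP->.
- by exists 1, 0, 0; lia.
- by exists 0, 1, 0; lia.
- by exists 0, 0, 1; lia.
Qed.

(** The permutation hypothesis lets one statement cover each of the three
    generators in turn. *)
Lemma minimal_generator_no_combination (m b c e x y : nat) :
  minimally_generate_numerical_semigroup [:: m; b; c] ->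
  perm_eq [:: m; b; c] [:: e; x; y] ->
  forall k l, e <> k * x + l * y.
Proof.
move=> smin sp k l ekl.
have := minimally_generate_perm sp smin => {}smin.
have [+ _ _] := smin; rewrite /= !inE => /and3P[/norP[ex ey] _ _].
apply: (minimal_generator_indispensable (b := e) smin).
  by rewrite inE eqxx.
have [S0 SD] := generated_submonoid ([set` [:: e; x; y]] `\ e).
rewrite {3}ekl -natrDE; apply: SD; apply: generated_muln.
  apply: sub_gen_smallest; split=> /=; first by rewrite !inE eqxx orbT.
  by apply/eqP; rewrite eq_sym.
apply: sub_gen_smallest; split=> /=; first by rewrite !inE eqxx !orbT.
by apply/eqP; rewrite eq_sym.
Qed.

(** For [m <= 1] one of the generators is a multiple of another. For [m = 2]
    the other two are odd, else they would be multiples of [m], and then [c]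
    is [b] plus a multiple of [m]. *)
Lemma multiplicity_ge3 (m b c : nat) :
  minimally_generate_numerical_semigroup [:: m; b; c] -> m < b < c -> 2 < m.
Proof.
move=> smin /andP[mb bc].
have mP := minimal_generator_no_combination smin (perm_refl _).
have /(minimal_generator_no_combination smin) bP :
    perm_eq [:: m; b; c] [:: b; m; c].
  by apply/permP => p /=; lia.
have /(minimal_generator_no_combination smin) cP :
    perm_eq [:: m; b; c] [:: c; m; b].
  by apply/permP => p /=; lia.
rewrite ltnNge; apply/negP => m2.
have [m0|[m1|m_eq2]] : m = 0 \/ m = 1 \/ m = 2 by lia.
- by apply: (mP 0 0); rewrite m0.
- by apply: (bP b 0); rewrite m1 muln1 mul0n addn0.
have := bP b./2 0; have := cP c./2 0; have := cP (c - b)./2 1.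
by rewrite m_eq2; lia.
Qed.

Lemma multiplicity_le (m b c n : nat) :
  m < b < c -> generated [set` [:: m; b; c]] n -> 0 < n -> m <= n.
Proof.
move=> mbc /generated3P[[|x] [y [z ->]]]; last by rewrite mulSn; lia.
case: y => [|y]; last by rewrite mulSn; lia.
by case: z => [|z]; last by rewrite mulSn; lia.
Qed.

Lemma frobenius_number (H : set nat) :
  numerical_semigroup H -> H != setT ->
  exists2 F, ~ H F & forall n, ~ H n -> n <= F.
Proof.
move=> [_ /finite_seqP[s gapsE]] /eqP HT.
have sP n : n \in s <-> ~ H n.
  by have -> : (n \in s : Prop) = (~` H) n by rewrite gapsE.
have exs : exists n, n \in s.
  apply: contrapT => s0; apply: HT; apply/seteqP; split=> // n _.
  by apply: contrapT => /sP ns; apply: s0; exists n.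
have bs n : n \in s -> n <= \max_(k <- s) k.
  by move=> ns; exact: (@leq_bigmax_seq _ _ xpredT id).
have [F /sP HF Fmax] := ex_maxnP exs bs.
by exists F => // n /sP; apply: Fmax.
Qed.

(** * Coordinates, order and cardinality *)

Lemma card_ge2 (T : Type) (A : set T) (x y : T) :
  A x -> A y -> x <> y -> `I_2 #<= A.
Proof.
move=> Ax Ay xy; have : [set x; y] `<=` A by move=> z [->|->].
move=> /subset_card_le; apply: card_le_trans.
have <- : [set (nat_of_bool `[< z = x >]) | z in [set x; y]] = `I_2.
  apply/seteqP; split=> [_ [z _ <-]|n /=]; first by case: asbool.
  case: n => [|[|//]] _; last first.
    by exists x; [left | rewrite asboolT].
  by exists y; [right | rewrite asboolF // => /esym].
exact: card_image_le.
Qed.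

Section Coordinates.

Variable d : nat.
Implicit Types (x y : 'rV[nat]_d) (j k : 'I_d).

Lemma addvE x y j : (x + y)%R ord0 j = x ord0 j + y ord0 j.
Proof. by rewrite mxE. Qed.

Lemma basis_mulrnE k n j : (basis_vec k *+ n)%R ord0 j = (j == k) * n.
Proof.
rewrite mulmxnE mxE eqxx /=; elim: n => [|n IHn]; first by rewrite muln0.
by rewrite GRing.mulrS IHn mulnS; case: eqP.
Qed.

Lemma basisE k j : basis_vec k ord0 j = (j == k).
Proof. by rewrite -[basis_vec k]GRing.mulr1n basis_mulrnE muln1. Qed.

Lemma sum_basis x : x = (\sum_j basis_vec j *+ x ord0 j)%R.
Proof.
apply/rowP => k; rewrite summxE (bigD1 k) //= big1 => [|j jk].
  by rewrite GRing.addr0 basis_mulrnE eqxx mul1n.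
by rewrite basis_mulrnE eq_sym (negPf jk).
Qed.

Lemma natural_leP x y : natural_le x y <-> forall j, x ord0 j <= y ord0 j.
Proof.
split=> [[z ->] j|xy]; first by rewrite addvE leq_addr.
exists (\row_j (y ord0 j - x ord0 j)%N)%R; apply/rowP => j.
by rewrite addvE mxE subnKC.
Qed.

End Coordinates.

(** * The window criterion for membership *)

(** The largest number of generators e_i + D_j e_j, counted over all j, that
    the coordinates of [x] other than [i] can pay for. *)
Definition max_shift (d : nat) (i : 'I_d) (D : 'I_d -> nat) (x : 'rV[nat]_d) :=
  \sum_(j | j != i) x ord0 j %/ D j.

Definition shift_semigroup (d : nat) (i : 'I_d) (D : 'I_d -> nat)
    (H : set nat) : set 'rV[nat]_d :=
  [set x | exists t,
    [/\ t <= max_shift i D x, t <= x ord0 i & H (x ord0 i - t)]].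

Section Membership.

Variables (d : nat) (i : 'I_d) (D : 'I_d -> nat).
Hypothesis hD : forall j : 'I_d, j != i -> 0 < D j.
Implicit Types (x y : 'rV[nat]_d).

(** Only superadditive: remainders may combine into one more generator. *)
Lemma max_shiftD x y :
  max_shift i D x + max_shift i D y <= max_shift i D (x + y)%R.
Proof.
rewrite /max_shift -big_split /=; apply: leq_sum => j ji.
by rewrite addvE leq_divRL ?hD // mulnDl leq_add ?leq_divM.
Qed.

Lemma shift_semigroup_submonoid H :
  submonoid H -> submonoid (shift_semigroup i D H).
Proof.
move=> [H0 HD]; split=> [|x y [t [tx txi Ht]] [u [uy uyi Hu]]].
  by exists 0; rewrite mxE subn0; split.
exists (t + u); rewrite addvE; split.
- exact: leq_trans (leq_add tx uy) (max_shiftD _ _).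
- exact: leq_add.
have -> : x ord0 i + y ord0 i - (t + u) = (x ord0 i - t) + (y ord0 i - u).
  by rewrite addnBA // addnBAC // subnDA.
exact: HD.
Qed.

(** The right-hand side is a submonoid containing the generators. Conversely,
    an element with shift [t] splits off [t] generators e_i + D_j e_j one at a
    time; what remains is h e_i, with h in the numerical semigroup, plus
    multiples of the other basis vectors. *)
Lemma generated_gen_setE a1 a2 a3 :
  generated (gen_set i a1 a2 a3 D) =
  shift_semigroup i D (generated [set` [:: a1; a2; a3]]).
Proof.
set H := generated [set` _]; set S := generated (gen_set _ _ _ _ _).
have sH : submonoid H := generated_submonoid _.
have [S0 SD] : submonoid S := generated_submonoid _.
apply/seteqP; split.
  apply: smallest_sub; first exact: shift_semigroup_submonoid.
  have [H0 _] := sH.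
  move=> z [[[j /= /eqP ji <-]|gen_ai]|[j /= /eqP ji <-]].
  - by exists 0; rewrite basisE eq_sym (negPf ji).
  - have {gen_ai}[a aP ->] : exists2 a, a \in [:: a1; a2; a3] &
        z = (basis_vec i *+ a)%R.
      by case: gen_ai => [[->|->]|->]; [exists a1 | exists a2 | exists a3];
        rewrite // !inE eqxx ?orbT.
    exists 0; rewrite basis_mulrnE eqxx mul1n subn0; split=> //.
    exact: sub_gen_smallest.
  - exists 1; rewrite addvE basisE eqxx basis_mulrnE eq_sym (negPf ji).
    split=> //; rewrite /max_shift (bigD1 j) //= addvE basis_mulrnE eqxx mul1n.
    by rewrite basisE (negPf ji) add0n divnn hD.
have Se j : j != i -> S (basis_vec j).
  by move=> ji; apply: sub_gen_smallest; left; left; exists j => //; exact/eqP.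
have SH h : H h -> S (basis_vec i *+ h)%R.
  suff : H `<=` [set h | S (basis_vec i *+ h)%R] by apply.
  apply: smallest_sub.
    split=> [|a b Sa Sb] /=; first by rewrite GRing.mulr0n.
    by rewrite GRing.mulrnDr; exact: SD.
  move=> a /=; rewrite !inE => /or3P a_gen.
  apply: sub_gen_smallest; left; right.
  by case: a_gen => /eqP->; [left; left | left; right | right].
suff mem_S t (x : 'rV[nat]_d) : t <= max_shift i D x -> t <= x ord0 i ->
    H (x ord0 i - t) -> S x.
  by move=> x [t [tx txi Hx]]; exact: mem_S Hx.
elim: t x => [|t IHt] x tx txi Hx.
  rewrite (sum_basis x) (bigD1 i) //=; apply: SD.
    by apply: SH; rewrite -[x _ _]subn0.
  by apply: generated_sum => j ji; apply: generated_mulrn; exact: Se.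
have /existsP[j /andP[ji xj]] : [exists j, (j != i) && (D j <= x ord0 j)].
  apply: contraTT tx => /existsPn x_small.
  rewrite -leqNgt /max_shift big1 // => j ji.
  by apply: divn_small; have := x_small j; rewrite ji /= ltnNge.
(* [v] is a generator that fits below [x]; removing it lowers the shift *)
pose v := (basis_vec i + basis_vec j *+ D j)%R.
pose y := (\row_k (x ord0 k - v ord0 k)%N)%R.
have vE k : v ord0 k = (k == i) + (k == j) * D j.
  by rewrite /v addvE basisE basis_mulrnE.
have xE : x = (v + y)%R.
  apply/rowP => k; rewrite addvE [y _ _]mxE subnKC // vE.
  have [->|_] := eqVneq k i; first by rewrite eq_sym (negPf ji); lia.
  by have [->|] := eqVneq k j; lia.
have yi : y ord0 i = (x ord0 i).-1.
  by rewrite [y _ _]mxE vE eqxx eq_sym (negPf ji) subn1.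
rewrite xE; apply: SD.
  by apply: sub_gen_smallest; right; exists j => //; exact/eqP.
apply: IHt; rewrite ?yi; last 2 first.
- by lia.
- by have -> : (x ord0 i).-1 - t = x ord0 i - t.+1 by lia.
move: tx; rewrite /max_shift (bigD1 j) //= [X in _ -> _ <= X](bigD1 j) //=.
have -> : x ord0 j = D j + y ord0 j.
  by rewrite {1}xE addvE vE (negPf ji) eqxx mul1n.
rewrite divnDl // divnn hD // => tx.
have e : \sum_(k | (k != i) && (k != j)) x ord0 k %/ D k =
         \sum_(k | (k != i) && (k != j)) y ord0 k %/ D k.
  apply: eq_bigr => k /andP[ki kj].
  by rewrite {1}xE addvE vE (negPf ki) (negPf kj).
by rewrite -e -ltnS; apply: leq_trans tx _; rewrite add1n.
Qed.

End Membership.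

(** * Gaps and Frobenius-allowable elements *)

(** Climb from [x] to larger and larger gaps; each step increases the sum of
    the coordinates, which is bounded. *)
Lemma FA_above (d : nat) (S : set 'rV[nat]_d) (B : nat) (x : 'rV[nat]_d) :
  (forall y, gaps S y -> \sum_j y ord0 j <= B) ->
  gaps S x -> exists2 M, FA S M & natural_le x M.
Proof.
move=> bounded; have [n] := ubnP (B - \sum_j x ord0 j).
elim: n x => // n IHn x le_n Sx.
have [xmax|] := pselect (FA S x).
  by exists x => //; exists 0%R; rewrite GRing.addr0.
move=> /not_andP[//|/existsNP[y /not_implyP[Sy /not_implyP[[z yE] yx]]]].
have z_gt0 : 0 < \sum_j z ord0 j.
  rewrite lt0n; apply: contra_notN yx; rewrite sum_nat_eq0 => /forallP z0.
  rewrite yE; have -> : z = 0%R; last by rewrite GRing.addr0.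
  by apply/rowP => j; rewrite mxE; exact/eqP/(implyP (z0 j)).
have yS : \sum_j y ord0 j = \sum_j x ord0 j + \sum_j z ord0 j.
  by rewrite -big_split; apply: eq_bigr => j _; rewrite yE addvE.
have [|M FAM [w ME]] := IHn y _ Sy.
  by have := bounded y Sy; rewrite yS; lia.
by exists M => //; exists (z + w)%R; rewrite ME yE GRing.addrA.
Qed.

Section Gaps.

Variables (d : nat) (i : 'I_d) (D : 'I_d -> nat).
Variables (H : set nat) (F : nat).
Local Notation S := (shift_semigroup i D H).
Hypothesis hD : forall j : 'I_d, j != i -> 0 < D j.
Hypothesis H0 : H 0.
Hypothesis FNH : ~ H F.
Hypothesis Fmax : forall n, ~ H n -> n <= F.

Lemma gapP x : gaps S x <->
  forall t, t <= max_shift i D x -> t <= x ord0 i -> ~ H (x ord0 i - t).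
Proof.
split=> [NS t tx txi Ht|NH [t [tx txi]]].
  by apply: NS; exists t.
exact: NH.
Qed.

(** The shift [x_i] would lead to [0], which lies in [H]. *)
Lemma gap_max_shift x : gaps S x -> max_shift i D x < x ord0 i.
Proof.
move=> /gapP NH; rewrite ltnNge; apply/negP => le_x.
by apply: (NH _ le_x); rewrite ?subnn.
Qed.

Lemma gap_leF x : gaps S x -> x ord0 i <= F.
Proof.
move=> /gapP/(_ 0) NH; apply: Fmax; rewrite -[x _ _]subn0; exact: NH.
Qed.

Lemma gaps_bounded x : gaps S x ->
  \sum_j x ord0 j <= F + \sum_(j | j != i) F * D j.
Proof.
move=> Sx; rewrite (bigD1 i) //= leq_add ?gap_leF //.
apply: leq_sum => j ji; rewrite ltnW // -ltn_divLR ?hD //.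
apply: leq_trans (gap_leF Sx); apply: leq_ltn_trans (gap_max_shift Sx).
by rewrite /max_shift (bigD1 j) //= leq_addr.
Qed.

Lemma max_shift_basis_pair j a b : j != i ->
  max_shift i D (basis_vec i *+ a + basis_vec j *+ b)%R = b %/ D j.
Proof.
move=> ji; rewrite /max_shift (bigD1 j) //= big1 => [|k /andP[ki kj]].
  by rewrite addvE !basis_mulrnE eqxx (negPf ji) mul1n addn0.
by rewrite addvE !basis_mulrnE (negPf ki) (negPf kj) div0n.
Qed.

Lemma gap_basis_pair j a b : j != i ->
  (forall t, t <= b %/ D j -> t <= a -> ~ H (a - t)) ->
  gaps S (basis_vec i *+ a + basis_vec j *+ b)%R.
Proof.
move=> ji NH; apply/gapP => t; rewrite max_shift_basis_pair //.
by rewrite addvE !basis_mulrnE eqxx eq_sym (negPf ji) mul1n addn0; apply: NH.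
Qed.

Variable m : nat.
Hypothesis m_gt2 : 2 < m.
Hypothesis Hm : forall k, H (k * m).
Hypothesis m_min : forall n, H n -> 0 < n -> m <= n.

(** Every gap lies below an element of [FA S], hence below the only one. The
    two conditions on [M] say that it lies above F e_i and above each
    (m-1) e_i + (m-2) D_j e_j. *)
Lemma dominating_gap : 1 < d -> ~ (`I_2 #<= FA S) ->
  exists2 M, gaps S M &
    M ord0 i = F /\ forall j, j != i -> m - 2 <= M ord0 j %/ D j.
Proof.
move=> d_gt1 FA1.
have [j0 j0i] : exists j : 'I_d, j != i.
  have : 0 < #|[set~ i]%SET| by rewrite cardsC1 card_ord; lia.
  by case/card_gt0P => j; rewrite !inE; exists j.
have above x := FA_above gaps_bounded (x := x).
(* the axis point F e_i, written with a dummy zero multiple of e_j0 *)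
have SF := gap_basis_pair (a := F) (b := 0) j0i _.
have [|M [SM Mmax] FM] := above _ (SF _).
  by move=> t; rewrite div0n leqn0 => /eqP-> _; rewrite subn0.
have below x : gaps S x -> natural_le x M.
  move=> /above[N FAN xN]; suff -> : M = N by [].
  by apply: contrapT => MN; apply: FA1; exact: card_ge2 MN.
exists M => //; split.
  apply/eqP; rewrite eqn_leq gap_leF //=; have /natural_leP/(_ i) := FM.
  by rewrite addvE !basis_mulrnE eqxx mul1n muln0 addn0.
move=> j ji; rewrite leq_divRL ?hD //.
(* the window of this point is 1, ..., m-1 *)
have /below/natural_leP/(_ j) :
    gaps S (basis_vec i *+ m.-1 + basis_vec j *+ ((m - 2) * D j))%R.
  apply: gap_basis_pair => // t; rewrite mulnK ?hD // => tm _ /m_min; lia.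
by rewrite addvE !basis_mulrnE eqxx (negPf ji) mul1n.
Qed.

(** Among [m] consecutive integers there is a multiple of [m]: the shift
    [x_i %% m] would lead into [H]. *)
Lemma max_shift_le_multiplicity x : gaps S x -> max_shift i D x <= m - 2.
Proof.
move=> Sx; have /gapP NH := Sx; rewrite leqNgt; apply/negP => lt_x.
apply: (NH (x ord0 i %% m)).
- have := ltn_pmod (x ord0 i) (ltnW (ltnW m_gt2)); lia.
- exact: leq_mod.
- by rewrite {1}(divn_eq (x ord0 i) m) addnK.
Qed.

(** Two indices other than [i] give the dominating gap a shift of at least
    [2 * (m - 2)], which exceeds [m - 2]. *)
Lemma card_FA_ge2 : 2 < d -> `I_2 #<= FA S.
Proof.
move=> d_gt2; apply: contrapT => /(dominating_gap (ltnW d_gt2))[M SM [_ Mj]].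
have : 1 < #|[set~ i]%SET| by rewrite cardsC1 card_ord; lia.
case/card_gt1P => j [k []]; rewrite !inE => ji ki jk.
have := max_shift_le_multiplicity SM.
rewrite /max_shift (bigD1 j) //= (bigD1 k) /=; last by rewrite ki eq_sym.
have := Mj j ji; have := Mj k ki; lia.
Qed.

(** The dominating gap has [i]-th coordinate [F] and admits every shift up to
    [m - 2]. *)
Lemma gap_run : 1 < d -> ~ (`I_2 #<= FA S) ->
  forall t, t <= m - 2 -> t <= F -> ~ H (F - t).
Proof.
move=> d_gt1 /(dominating_gap d_gt1)[M SM [MF Mj]] t tm.
have : 0 < #|[set~ i]%SET| by rewrite cardsC1 card_ord; lia.
case/card_gt0P => j; rewrite !inE => ji.
have /gapP/(_ t) := SM; rewrite MF; apply; apply: leq_trans tm _.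
by apply: leq_trans (Mj j ji) _; rewrite /max_shift (bigD1 j) //= leq_addr.
Qed.

End Gaps.

(** * The shape of the numerical semigroup in dimension two *)

(** Let [F = q * m + (m - 1)]; the run of gaps is
    [q * m + 1, ..., q * m + (m - 1)], and everything above it is in [H].
    Adding multiples of [m] to an element of [H] below the run that is not a
    multiple of [m] would lead into the run, so [b] and [c] exceed
    [q.+1 * m]. Each [q.+1 * m + j] with [0 < j < m] is in [H], but does not
    involve [m] since subtracting [m] gives a gap; as a sum of copies of [b]
    and [c] it is too small to have two terms. So the [m - 1] such numbers are
    among [b] and [c]. *)
Lemma long_last_run (m b c F : nat) (H := generated [set` [:: m; b; c]]) :
  minimally_generate_numerical_semigroup [:: m; b; c] -> m < b < c ->
  ~ H F -> (forall n, ~ H n -> n <= F) ->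
  (forall t, t <= m - 2 -> t <= F -> ~ H (F - t)) ->
  m = 3 /\ (b = 1 %[mod 3] /\ c = b + 1).
Proof.
move=> smin mbc FNH Fmax run.
have m_gt2 := multiplicity_ge3 smin mbc.
have [H0 HD] : submonoid H := generated_submonoid _.
have Hgen x : x \in [:: m; b; c] -> H x by move=> xs; exact: sub_gen_smallest.
have Hm k : H (k * m) by apply: generated_muln; apply: Hgen; rewrite inE eqxx.
have bP k : b <> k * m.
  have /(minimal_generator_no_combination smin)/(_ k 0) :
      perm_eq [:: m; b; c] [:: b; m; c] by apply/permP => p /=; lia.
  by rewrite mul0n addn0.
have HS n : F < n -> H n by move=> Fn; apply: contrapT => /Fmax; lia.
pose q := F %/ m.
have FE : F = q * m + (m - 1).
  have := divn_eq F m; rewrite -/q => FE.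
  suff : m - 2 < F %% m by have := ltn_pmod F (ltnW (ltnW m_gt2)); lia.
  rewrite ltnNge; apply/negP => /run; apply; first exact: leq_mod.
  by rewrite {1}FE addnK.
(* the run of gaps, indexed by residues *)
have gap r : 0 < r < m -> ~ H (q * m + r).
  move=> r_m; have -> : q * m + r = F - (m - 1 - r) by lia.
  by apply: run; lia.
have b_gt : q.+1 * m < b.
  rewrite ltnNge; apply/negP => b_le; have bE := divn_eq b m.
  have r_lt := ltn_pmod b (ltnW (ltnW m_gt2)).
  have bqm := bP q.+1; have bqm' := bP (b %/ m).
  have bq : b %/ m <= q by rewrite -ltnS ltn_divLR; lia.
  apply: (gap (b %% m)); first by lia.
  have -> : q * m + b %% m = (q - b %/ m) * m + b.
    by rewrite {3}bE addnA -mulnDl subnK.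
  by apply: HD => //; apply: Hgen; rewrite !inE eqxx orbT.
have bcP j : 0 < j < m -> q.+1 * m + j = b \/ q.+1 * m + j = c.
  move=> j_m; have /generated3P[x [y [z E]]] : H (q.+1 * m + j).
    by apply: HS; lia.
  case: x E => [|x] E.
    (* b and c exceed q.+1 * m >= m > j, so two of them already overshoot *)
    by case: y z E => [|[|y]] [|[|z]]; rewrite ?mulSn; lia.
  exfalso; apply: (gap j j_m).
  have -> : q * m + j = x * m + y * b + z * c by move: E; rewrite !mulSn; lia.
  by apply: (HD); [apply: HD|]; apply: generated_muln; apply: Hgen;
    rewrite !inE eqxx ?orbT.
have m3 : m = 3.
  have := bcP 1; have := bcP 2; have := bcP 3; lia.
split=> //; have := bcP 1; have := bcP 2; rewrite m3 => c2 c1.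
have [bE cE] : b = q.+1 * 3 + 1 /\ c = q.+1 * 3 + 2 by lia.
by rewrite bE cE modnMDl; split; lia.
Qed.

(** The semigroup consists of the multiples of [3] and of all integers from
    [k * 3] on. *)
Lemma frobenius_3 (b c F k : nat) (H := generated [set` [:: 3; b; c]]) :
  b = k * 3 + 1 -> c = b + 1 -> 1 < b ->
  ~ H F -> (forall n, ~ H n -> n <= F) ->
  F = k * 3 - 1 /\ ~ H (F - 1).
Proof.
move=> bE cE b_gt1 FNH Fmax.
have [H0 HD] : submonoid H := generated_submonoid _.
have Hgen x : x \in [:: 3; b; c] -> H x by move=> xs; exact: sub_gen_smallest.
have gap r : 0 < r < 3 -> ~ H ((k - 1) * 3 + r).
  move=> r3 /generated3P[x [[|y] [[|z]]]]; rewrite ?mulSn; lia.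
have FE : F = k * 3 - 1.
  apply/eqP; rewrite eqn_leq; apply/andP; split; last first.
    by have /Fmax := gap 2 isT; lia.
  rewrite leqNgt; apply/negP => F_ge; apply: FNH.
  have H3 l : H (l * 3) by apply: generated_muln; apply: Hgen.
  have Hb : H b by apply: Hgen; rewrite !inE eqxx orbT.
  have Hc : H c by apply: Hgen; rewrite !inE eqxx !orbT.
  have [F0|[F1|F2]] : F %% 3 = 0 \/ F %% 3 = 1 \/ F %% 3 = 2 by lia.
  - by have -> : F = F %/ 3 * 3 by lia.
  - have -> : F = (F %/ 3 - k) * 3 + b by lia.
    exact: HD.
  - have -> : F = (F %/ 3 - k) * 3 + c by lia.
    exact: HD.
split=> //; have -> : F - 1 = (k - 1) * 3 + 1 by lia.
exact: gap.
Qed.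

(** A gap has shift at most [1], as multiples of [3] are in [H]; so its
    coordinate [i] is at most [F] and its coordinate [j] below [2 * D j]. The
    point attaining both bounds is a gap, because [F] and [F - 1] are. *)
Lemma card_FA_eq1 (i j : 'I_2) (D : 'I_2 -> nat) (H : set nat) (F : nat) :
  j != i -> 0 < D j -> H 0 ->
  (forall k, H (k * 3)) -> (forall n, ~ H n -> n <= F) ->
  ~ H F -> ~ H (F - 1) -> FA (shift_semigroup i D H) #= `I_1.
Proof.
move=> ji Dj H0 H3 Fmax FNH F1NH.
have onlyj k : k != i -> k = j.
  move: ji; rewrite -!val_eqE /= => ji ki; apply: val_inj => /=.
  by have := ltn_ord i; have := ltn_ord j; have := ltn_ord k; lia.
have hD k : k != i -> 0 < D k by move=> /onlyj->.
pose M := (basis_vec i *+ F + basis_vec j *+ (2 * D j).-1)%R.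
set S := shift_semigroup i D H.
have SM : gaps S M.
  apply: gap_basis_pair => // t.
  have -> : (2 * D j).-1 = 1 * D j + (D j).-1 by lia.
  rewrite divnMDl // divn_small; last by lia.
  by case: t => [|[|]]; rewrite ?subn0.
have below x : gaps S x -> natural_le x M.
  move=> Sx; apply/natural_leP => k; rewrite addvE !basis_mulrnE.
  have [->|/onlyj->] := eqVneq k i.
    by rewrite mul1n; apply: leq_trans (gap_leF Fmax Sx) (leq_addr _ _).
  have := max_shift_le_multiplicity (m := 3) isT H3 Sx.
  rewrite /max_shift (bigD1 j) //= => x_le.
  have : x ord0 j %/ D j < 2 by lia.
  by rewrite eqxx ltn_divLR //; lia.
have anti x : natural_le M x -> natural_le x M -> x = M.
  move=> /natural_leP Mx /natural_leP xM; apply/rowP => k.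
  by apply/eqP; rewrite eqn_leq; apply/andP; split; [exact: xM | exact: Mx].
suff -> : FA S = [set M] by exact: card_set1.
apply/seteqP; split=> [x [Sx xmax]|_ ->].
  by rewrite /= (xmax M) //; exact: below.
by split=> // y /below yM My; exact: anti.
Qed.

(** * Main result *)

(** In dimension three or more the generators come in no particular order, but
    the arguments on [H] need the smallest one. *)
Lemma minimally_generate_sorted (a1 a2 a3 : nat) :
  minimally_generate_numerical_semigroup [:: a1; a2; a3] ->
  exists m b c, perm_eq [:: m; b; c] [:: a1; a2; a3] /\ m < b < c.
Proof.
move=> [us _ _]; have /permPl ps := perm_sort leq [:: a1; a2; a3].
have := sort_sorted leq_total [:: a1; a2; a3].
have := perm_size ps; have := perm_uniq ps; rewrite us.
case: (sort _ _) ps => [|m [|b [|c [|]]]] // ps us' _ so; exists m, b, c.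
by split=> //; move: us' so; rewrite /= !inE; lia.
Qed.

Theorem lemma2p1 (d : nat) (hd : 1 < d) (i : 'I_d) (a1 a2 a3 : nat)
    (D : 'I_d -> nat)
    (ha : minimally_generate_numerical_semigroup [:: a1; a2; a3])
    (hD : forall j : 'I_d, j != i -> 0 < D j) :
  let S := generated (gen_set i a1 a2 a3 D) in
  [/\ 3 <= d -> `I_2 #<= FA S,
      d = 2 -> a1 < a2 < a3 -> a1 <> 3 -> `I_2 #<= FA S
    & d = 2 -> a1 < a2 < a3 -> a1 = 3 ->
        (FA S #= `I_1 <-> a2 = 1 %[mod 3] /\ a3 = a2 + 1)].
Proof.
rewrite (generated_gen_setE hD); set H := generated _; move=> S.
have [H0 _] : submonoid H := generated_submonoid _.
have [m [b [c [ps mbc]]]] := minimally_generate_sorted ha.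
have smin : minimally_generate_numerical_semigroup [:: m; b; c].
  by apply: minimally_generate_perm ha; rewrite perm_sym.
have HE : H = generated [set` [:: m; b; c]].
  by congr generated; apply/seteqP; split=> x /=; rewrite (perm_mem ps).
have m_gt2 := multiplicity_ge3 smin mbc.
have m_min n : H n -> 0 < n -> m <= n.
  by rewrite HE; apply: multiplicity_le.
have Hm k : H (k * m).
  rewrite HE; apply: generated_muln; apply: sub_gen_smallest.
  by rewrite /= inE eqxx.
have [F FNH Fmax] : exists2 F, ~ H F & forall n, ~ H n -> n <= F.
  have [_ sH _] := ha; apply: frobenius_number => //.
  apply/eqP => HT; have : H 1 by rewrite HT.
  by move=> /m_min; lia.
have sortedE : a1 < a2 < a3 -> [/\ m = a1, b = a2 & c = a3].
  move=> a123; suff [] : [:: m; b; c] = [:: a1; a2; a3] by [].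
  apply: (irr_sorted_eq ltn_trans ltnn); rewrite /= ?andbT //.
  exact: perm_mem.
have run := gap_run hD H0 FNH Fmax m_gt2 m_min hd.
split.
- by move=> d3; exact: (card_FA_ge2 hD H0 FNH Fmax m_gt2 Hm m_min).
- move=> _ a123 a1n3; apply: contrapT => /run long.
  have [aE _ _] := sortedE a123; rewrite -aE in a1n3.
  rewrite HE in FNH Fmax long.
  by have [] := long_last_run smin mbc FNH Fmax long.
move=> d2 a123 a1_3; have [mE bE cE] := sortedE a123.
rewrite -bE -cE; split=> [FA1|[b1 cb]].
  have long : ~ (`I_2 #<= FA S) by rewrite (card_le_eqr FA1) card_le_II.
  move: (run long); rewrite HE in FNH Fmax * => {}run.
  by have [] := long_last_run smin mbc FNH Fmax run.
have [k bk] : exists k, b = k * 3 + 1 by exists (b %/ 3); lia.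
have m3 : m = 3 by rewrite mE.
have [_ F1NH] : F = k * 3 - 1 /\ ~ H (F - 1).
  by rewrite HE m3 in FNH Fmax *; apply: frobenius_3 FNH Fmax => //; lia.
rewrite m3 in Hm; have [j ji] : exists j : 'I_d, j != i.
  have : 0 < #|[set~ i]%SET| by rewrite cardsC1 card_ord; lia.
  by case/card_gt0P => j; rewrite !inE; exists j.
clear run; subst d.
exact: (card_FA_eq1 ji (hD j ji) H0 Hm Fmax FNH F1NH).
Qed.
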